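(* Let $H$ be a graph with $\chi(H)=r\geq 3$. Then $$\delta_{\chi}^{\mathrm{VC}}(H)=\begin{cases}\dfrac{r-3}{r-2}, & \text{if } \mathcal{M}(H) \text{ contains a forest},\\[6pt] \dfrac{r-2}{r-1}, & \text{otherwise}.\end{cases}$$
   Context: All graphs are finite and simple; $\chi(G)$ is the chromatic number and $\delta(G)$ the minimum degree of $G$. A graph $G$ is $H$-free if it contains no (not necessarily induced) subgraph isomorphic to $H$. VC-dimension: for a set system $\mathcal{F}\subseteq 2^X$ and $Y\subseteq X$, put $\mathcal{F}|_Y=\{F\cap Y: F\in\mathcal{F}\}$; $Y$ is shattered by $\mathcal{F}$ if $\mathcal{F}|_Y=2^Y$, and $\mathrm{VC}(\mathcal{F})$ is the maximum order of a set shattered by $\mathcal{F}$. For a graph $G$, $\mathrm{VC}(G):=\mathrm{VC}(\{N_G(v):v\in V(G)\})$, where $N_G(v)$ is the neighborhood of $v$. Bounded-VC chromatic threshold: $\delta_{\chi}^{\mathrm{VC}}(H)$ is the infimum of all $c\geq 0$ such that for every $d\in\mathbb{N}$ there exists a constant $C=C(H,c,d)$ such that every $n$-vertex $H$-free graph $G$ with $\mathrm{VC}(G)\leq d$ and $\delta(G)\geq cn$ satisfies $\chi(G)\leq C$. Decomposition family: for a graph $H$ with $\chi(H)=r$, $\mathcal{M}(H)$ is the family of bipartite graphs obtained from $H$ by deleting $r-2$ color classes in some proper $r$-coloring of $H$ (i.e. all graphs $H[V_1\cup V_2]$ where $V_1,\dots,V_r$ are the color classes of a proper $r$-coloring of $H$).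 A forest is a graph with no cycle. *)

(* Defs.v *)
From HB Require Import structures.
From mathcomp Require Import all_boot all_order all_algebra.
From mathcomp Require Import boolp classical_sets reals.

Set Implicit Arguments.
Unset Strict Implicit.
Unset Printing Implicit Defensive.

Import Order.TTheory GRing.Theory Num.Theory.

Record sgraph := SGraph {
  svertex :> finType;
  adj : rel svertex;
  adj_sym : symmetric adj;
  adj_irr : irreflexive adj }.

Section Graphs.

Variable G : sgraph.

Definition nbhd (x : G) : {set G} := [set y | adj x y].

(* The default #|G| exceeds every degree, so it matters only for the graph
   with no vertex, whose minimum degree is thereby 0. *)
Definition mindeg : nat := \big[minn/#|G|]_(x : G) #|nbhd x|.

Definition proper_coloring k (f : {ffun G -> 'I_k}) : bool :=
  [forall x, forall y, adj x y ==> (f x != f y)].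

Definition colorable k : bool := [exists f : {ffun G -> 'I_k}, proper_coloring f].

Lemma colorable_card : exists k, colorable k.
Proof.
exists #|G|; apply/existsP; exists [ffun x => enum_rank x].
apply/forallP => x; apply/forallP => y; apply/implyP => xy.
rewrite !ffunE (inj_eq enum_rank_inj).
by apply: contraTneq xy => ->; rewrite adj_irr.
Qed.

Definition chromatic_number : nat := ex_minn colorable_card.

Definition is_forest : Prop :=
  ~ exists c : seq G, (3 <= size c)%N /\ ucycle (@adj G) c.

Definition induced_adj (S : {set G}) : rel {x : G | x \in S} :=
  fun u v => adj (val u) (val v).

Lemma induced_adj_sym S : symmetric (@induced_adj S).
Proof. by move=> u v; apply: adj_sym. Qed.

Lemma induced_adj_irr S : irreflexive (@induced_adj S).
Proof. by move=> u; apply: adj_irr. Qed.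

Definition induced (S : {set G}) : sgraph :=
  SGraph (@induced_adj_sym S) (@induced_adj_irr S).

(* Every one of the chromatic_number color classes is nonempty, by minimality. *)
Definition decomposition_family (M : sgraph) : Prop :=
  exists (f : {ffun G -> 'I_chromatic_number}) (i j : 'I_chromatic_number),
    [/\ proper_coloring f, i != j &
        M = induced (f @^-1: [set i] :|: f @^-1: [set j])].

End Graphs.

Definition contains (G H : sgraph) : Prop :=
  exists f : H -> G, injective f /\ forall x y, adj x y -> adj (f x) (f y).

Definition free (H G : sgraph) : Prop := ~ contains G H.

Section VC.

Variables (X : finType) (F : {set {set X}}).

Definition trace (Y : {set X}) : {set {set X}} := [set A :&: Y | A in F].

Definition shattered (Y : {set X}) : bool := trace Y == powerset Y.

Definition VC : nat := \max_(Y : {set X} | shattered Y) #|Y|.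

End VC.

Definition graph_VC (G : sgraph) : nat := VC [set nbhd v | v : G].

Local Open Scope ring_scope.

(* The set below contains 1 and is bounded below by 0, so inf is a genuine
   infimum. *)
Definition VC_chromatic_threshold (R : realType) (H : sgraph) : R :=
  inf [set c : R | 0 <= c /\
    forall d : nat, exists C : nat, forall G : sgraph,
      free H G -> (graph_VC G <= d)%N ->
      c * #|G|%:R <= (mindeg G)%:R ->
      (chromatic_number G <= C)%N]%classic.

(* Main.v *)
Require Import Defs.
From HB Require Import structures.
From mathcomp Require Import all_boot all_order all_algebra.
From mathcomp Require Import boolp classical_sets reals.
From mathcomp Require Import fintype finset zify lra.

(** Consider the numbers [s] such that the vertices of [H] are those of an
    induced forest together with [s] independent sets ([splits]).  A forest is
    2-colourable, so [s] is at least [r - 2], and [r - 2] is possible exactly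
    when the decomposition family of [H] contains a forest
    ([splits_decomposition]); a proper [r]-colouring with one class taken as the
    forest shows that [r - 1] is always possible.  The threshold turns out to be
    [s / s.+1] for the largest [s] with which [H] does not split, which is
    [r - 3] or [r - 2] ([threshold_eq]).

    Lower bound.  If [H] does not split with [s] independent sets, take a graph
    [F] of large girth and large chromatic number
    ([erdos_girth_chromatic]) and put it inside one part of a balanced complete
    [s.+1]-partite graph ([multi]).  A copy of [H] in it would meet [F] in a
    forest and the other parts in [s] independent sets.  The minimum degree is
    at least [s / s.+1] times the order, and the VC-dimension is at most 4
    because [F] has no 4-cycle.

    Upper bound.  Let the minimum degree exceed [s / s.+1] times the order by a
    positive proportion.  When no member of the decomposition family is a
    forest, [s.+2 = r] and the Erdos-Stone theorem ([erdos_stone]) bounds the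
    order of an [H]-free graph.  Otherwise [H] splits with [s.+1] independent
    sets.  By the packing lemma for bounded VC-dimension ([packing]) the
    vertices fall into boundedly many classes such that two vertices of one
    class have nearly the same neighbourhood.  If a class has large chromatic
    number, it contains the forest part of [H]
    ([noncolorable_contains_acyclic]).  The vertices used have nearly a whole
    neighbourhood in common, and the induced graph on it is dense enough to
    contain, again by Erdos-Stone, a blow-up of the complete graph on [s.+1]
    vertices, which completes a copy of [H].  So in an [H]-free graph every
    class has bounded chromatic number. *)

Set Implicit Arguments.
Unset Strict Implicit.
Unset Printing Implicit Defensive.

Import Order.TTheory GRing.Theory Num.Theory.

(** * Counting *)

(** Reduce to linear against exponential: [n.+1] is at most [d * 2 ^ (n / d)]. *)
Lemma exp_dominates_poly a d :
  exists n0, forall n, n0 <= n -> a * n.+1 ^ d < 2 ^ n.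
Proof.
have le_exp n : n.+1 ^ d.+1 <= d.+1 ^ d.+1 * 2 ^ n.
  apply: (@leq_trans ((d.+1 * 2 ^ (n %/ d.+1)) ^ d.+1)).
    rewrite leq_exp2r //; apply: (@leq_trans (d.+1 * (n %/ d.+1).+1)).
      by rewrite mulnC; apply: ltn_ceil.
    by rewrite leq_mul2l ltn_expl.
  by rewrite expnMn -expnM leq_mul2l leq_exp2l // leq_divM orbT.
exists (a * d.+1 ^ d.+1) => n an.
have C0 : 0 < d.+1 ^ d.+1 by rewrite expn_gt0.
rewrite -(ltn_pmul2l C0); apply: leq_trans (le_exp n).
by rewrite mulnA (expnS n.+1) ltn_mul2r expn_gt0 /= ltnS mulnC.
Qed.

(** The first two terms of the binomial expansion already double the power. *)
Lemma double_pred_exp p : 2 * p ^ p.+1 <= p.+1 ^ p.+1.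
Proof.
have bern n : p ^ n.+1 + n.+1 * p ^ n <= p.+1 ^ n.+1.
  elim: n => [|n IHn]; first by rewrite !expn1 expn0; lia.
  rewrite (expnS p.+1) (expnS p n.+1).
  apply: leq_trans (leq_mul (leqnn p.+1) IHn).
  by rewrite (expnS p n); nia.
by apply: leq_trans (bern p); rewrite expnS; lia.
Qed.

Lemma exp_ratio p n : 2 ^ n * p ^ (p.+1 * n) <= p.+1 ^ (p.+1 * n).
Proof.
rewrite !expnM -expnMn; case: n => [|n]; first by rewrite !expn0.
by rewrite leq_exp2r // double_pred_exp.
Qed.

Lemma bin_le_exp n l : 'C(n, l) <= n ^ l.
Proof.
apply: (@leq_trans (n ^_ l)); first by rewrite -bin_ffact leq_pmulr // fact_gt0.
by rewrite ffact_prod -[X in _ <= n ^ X]card_ord -prod_nat_const leq_prod // => i _; lia.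
Qed.

Lemma sum_bin_le n d : \sum_(i < d.+1) 'C(n, i) <= n.+1 ^ d.
Proof.
elim: d => [|d IHd]; first by rewrite big_ord_recr big_ord0 /= bin0.
rewrite big_ord_recr /= expnS mulSn leq_add //.
apply: leq_trans (bin_le_exp n d.+1) _.
rewrite expnS leq_mul2l; case: d {IHd} => [|d]; first by rewrite orbT.
by rewrite leq_exp2r // leqnSn orbT.
Qed.

Lemma card_bigcup_le (I : Type) (r : seq I) (Q : pred I) (T : finType)
    (F : I -> {set T}) :
  #|\bigcup_(i <- r | Q i) F i| <= \sum_(i <- r | Q i) #|F i|.
Proof.
elim/big_rec2: _ => [|i n U _ UE]; first by rewrite cards0.
by rewrite (leq_trans (leq_card_setU _ _).1) ?leq_add2l.
Qed.

Lemma card_small_subsets (T : finType) (S : {set T}) d :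
  #|[set Y : {set T} | (Y \subset S) && (#|Y| <= d)]| <= #|S|.+1 ^ d.
Proof.
apply: leq_trans (sum_bin_le _ _).
have -> : [set Y : {set T} | (Y \subset S) && (#|Y| <= d)] =
  \bigcup_(i < d.+1) [set Y : {set T} | (Y \subset S) && (#|Y| == i)].
  apply/setP => Y; rewrite inE; apply/andP/bigcupP => [[YS Yd]|[i _]].
    by exists (inord #|Y|) => //; rewrite inE inordK // YS /=.
  by rewrite inE => /andP[-> /eqP->]; split=> //; rewrite -ltnS.
apply: leq_trans (card_bigcup_le _ _ _) _.
by apply: leq_sum => i _; rewrite cards_draws.
Qed.

(** * Shattered sets and packings *)

Lemma shatteredP (X : finType) (F : {set {set X}}) (Y : {set X}) :
  reflect (forall Z : {set X}, Z \subset Y -> exists2 A, A \in F & A :&: Y = Z)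
          (shattered F Y).
Proof.
apply: (iffP eqP) => [trE Z ZY|shF].
  by have : Z \in trace F Y; [rewrite trE inE | case/imsetP => A AF ->; exists A].
apply/setP => Z; rewrite inE; apply/imsetP/idP => [[A _ ->]|/shF[A AF <-]].
  exact: subsetIr.
by exists A.
Qed.

Lemma shatteredS (X : finType) (F F' : {set {set X}}) (Y : {set X}) :
  F \subset F' -> shattered F Y -> shattered F' Y.
Proof.
move=> /subsetP sF /shatteredP shF; apply/shatteredP => Z /shF[A /sF AF <-].
by exists A.
Qed.

(** Pajor's strengthening of the Sauer-Shelah lemma.  Split [F] along a point
    [x] that separates two members.  A set shattered by both halves avoids
    [x], and adding [x] to it gives a further set shattered by [F], so the
    numbers of shattered sets of the two halves add up. *)
Lemma pajor (X : finType) (F : {set {set X}}) :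
  #|F| <= #|[set Y | shattered F Y]|.
Proof.
have [n] := ubnP #|F|; elim: n F => // n IHn F leFn.
have [F1|] := leqP #|F| 1.
  have [->|[A AF]] := set_0Vmem F; first by rewrite cards0.
  apply: leq_trans F1 _; apply/card_gt0P; exists set0; rewrite inE.
  apply/shatteredP => Z; rewrite subset0 => /eqP->.
  by exists A => //; rewrite setI0.
case/card_gt1P => A [B [AF BF nAB]].
have {AF BF nAB} [x [C [D [CF DF xC xD]]]] :
    exists x C D, [/\ C \in F, D \in F, x \in C & x \notin D].
  have [/eqP|] := boolP (A \subset B); last first.
    by case/subsetPn => x xA xB; exists x, A, B.
  move=> /eqP AB; have [BA|] := boolP (B \subset A).
    by case/eqP: nAB; apply/eqP; rewrite eqEsubset AB.
  by case/subsetPn => x xB xA; exists x, B, A.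
pose F1 := [set A in F | x \in A]; pose F0 := [set A in F | x \notin A].
have cardF : #|F| = #|F1| + #|F0|.
  rewrite -(cardsID [set A : {set X} | x \in A] F); congr (_ + _).
    by apply: eq_card => E; rewrite !inE.
  by apply: eq_card => E; rewrite !inE andbC.
have F1_gt0 : 0 < #|F1| by apply/card_gt0P; exists C; rewrite inE CF.
have F0_gt0 : 0 < #|F0| by apply/card_gt0P; exists D; rewrite inE DF.
have notin1 Y : shattered F1 Y -> x \notin Y.
  move=> /shatteredP shY; apply/negP => xY.
  have [|E] := shY set0; first exact: sub0set.
  by rewrite inE => /andP[_ xE] /setP/(_ x); rewrite !inE xE xY.
have notin0 Y : shattered F0 Y -> x \notin Y.
  move=> /shatteredP shY; apply/negP => xY.
  have [|E] := shY Y; first exact: subxx.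
  by rewrite inE => /andP[_ xE] /setP/(_ x); rewrite !inE xY (negPf xE).
pose S1 := [set Y | shattered F1 Y]; pose S0 := [set Y | shattered F0 Y].
have le1 : #|F1| <= #|S1| by apply: IHn; lia.
have le0 : #|F0| <= #|S0| by apply: IHn; lia.
rewrite cardF; apply: leq_trans (leq_add le1 le0) _.
rewrite -cardsUI -(@card_in_imset _ _ (fun Y => x |: Y) (S1 :&: S0)); last first.
  move=> Y Z; rewrite !inE => /andP[/notin1 xY _] /andP[/notin1 xZ _] /= eYZ.
  by rewrite -(setU1K xY) eYZ setU1K.
rewrite -cardsUI [X in _ + X]eq_card0 ?addn0; last first.
  move=> Y; rewrite !inE; apply/negP => /andP[xY /imsetP[Z _ YZ]].
  have : x \in Y by rewrite YZ setU11.
  by apply/negP; case/orP: xY; [apply: notin1 | apply: notin0].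
apply/subset_leq_card/subsetP => Y; rewrite !inE => /orP[/orP[]|].
- by apply: shatteredS; apply/subsetP => E; rewrite inE => /andP[].
- by apply: shatteredS; apply/subsetP => E; rewrite inE => /andP[].
case/imsetP => Z; rewrite !inE => /andP[sh1 sh0] ->{Y}.
have xZ := notin1 _ sh1.
apply/shatteredP => W; rewrite -subDset => WZ.
have traceE (E : {set X}) : (x \in E) = (x \in W) -> E :&: Z = W :\: [set x] ->
    E :&: (x |: Z) = W.
  move=> xEW /setP EZ; apply/setP => y; rewrite !inE.
  have := EZ y; rewrite !inE.
  case: (altP (y =P x)) => [->|nyx] /=; last by [].
  by rewrite andbT.
have [xW|xW] := boolP (x \in W).
- have /shatteredP/(_ _ WZ)[E] := sh1; rewrite inE => /andP[EF xE] EZ.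
  by exists E => //; apply: traceE; rewrite ?xE.
- have /shatteredP/(_ _ WZ)[E] := sh0; rewrite inE => /andP[EF xE] EZ.
  by exists E => //; apply: traceE; rewrite ?(negPf xE) ?(negPf xW).
Qed.

Lemma shattered_le_VC (X : finType) (F : {set {set X}}) (Y : {set X}) :
  shattered F Y -> #|Y| <= VC F.
Proof. by move=> shY; rewrite /VC (bigD1 Y) //= leq_maxl. Qed.

Lemma VC_le (X : finType) (F : {set {set X}}) d :
  (forall Y, shattered F Y -> #|Y| <= d) -> VC F <= d.
Proof. by move=> h; apply/bigmax_leqP. Qed.

Lemma VC_subset (X : finType) (F F' : {set {set X}}) :
  F \subset F' -> VC F <= VC F'.
Proof.
by move=> sF; apply: VC_le => Y /(shatteredS sF); apply: shattered_le_VC.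
Qed.

Lemma sauer_shelah (X : finType) (F : {set {set X}}) (S : {set X}) d :
  VC F <= d -> #|trace F S| <= #|S|.+1 ^ d.
Proof.
move=> VCd; apply: leq_trans (pajor _) _.
apply: leq_trans (card_small_subsets S d); apply/subset_leq_card/subsetP => Y.
rewrite !inE => /shatteredP shY.
have YS : Y \subset S.
  have [E /imsetP[A _ ->] <-] := shY Y (subxx Y).
  by apply: subset_trans (subsetIl _ _) _; apply: subsetIr.
rewrite YS; apply: leq_trans VCd; apply: shattered_le_VC.
apply/shatteredP => Z /shY[E /imsetP[A AF ->] <-]; exists A => //.
by rewrite -setIA (setIidPr YS).
Qed.

Definition symdiff (X : finType) (A B : {set X}) := (A :\: B) :|: (B :\: A).

(** Some point lies in at least a [1 / p.+1] fraction of the symmetric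
    differences of the pairs not yet told apart, by averaging; choosing such a
    point repeatedly makes the number of these pairs decay geometrically. *)
Lemma greedy_separation (X : finType) (F : {set {set X}}) p l :
  (forall A B, A \in F -> B \in F -> A != B -> #|X| <= p.+1 * #|symdiff A B|) ->
  exists2 S : {set X}, #|S| <= l &
    #|[set P in setX F F | (P.1 != P.2) && (P.1 :&: S == P.2 :&: S)]|
      * p.+1 ^ l <= #|F| ^ 2 * p ^ l.
Proof.
move=> far; pose U (S : {set X}) :=
  [set P in setX F F | (P.1 != P.2) && (P.1 :&: S == P.2 :&: S)].
elim: l => [|l [S Sl leU]].
  exists set0; rewrite ?cards0 // !expn0 !muln1 -mulnn -cardsX.
  by apply/subset_leq_card/subsetP => P; rewrite inE => /andP[].
have [U0|[P0 P0U]] := set_0Vmem (U S).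
  by exists S; [apply: leqW | rewrite -/(U S) U0 cards0].
pose Ux x := [set P in U S | x \in symdiff P.1 P.2].
have sumU : #|U S| * #|X| <= p.+1 * \sum_x #|Ux x|.
  have -> : \sum_x #|Ux x| = \sum_(P in U S) #|symdiff P.1 P.2|.
    under eq_bigr => x _ do rewrite -sum1_card.
    rewrite (exchange_big_dep (mem (U S))) /=; last by move=> x P _; rewrite inE => /andP[].
    by apply: eq_bigr => P PU; rewrite -sum1_card; apply: eq_bigl => x; rewrite inE PU.
  rewrite big_distrr /= -sum_nat_const; apply: leq_sum => P.
  by rewrite !inE => /andP[/andP[P1 P2] /andP[nP _]]; apply: far.
have [x xU] : exists x, #|U S| <= p.+1 * #|Ux x|.
  apply/existsP; apply: contraT; rewrite negb_exists => /forallP lt.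
  have X0 : 0 < #|X|.
    have := P0U; rewrite !inE => /andP[_ /andP[nP _]].
    rewrite lt0n; apply: contra nP => /eqP X0.
    by apply/eqP/setP => x; have := card0_eq X0 x; rewrite inE.
  have [x0 _] := card_gt0P X0.
  suff : p.+1 * \sum_x #|Ux x| < #|U S| * #|X| by rewrite ltnNge sumU.
  rewrite big_distrr /= mulnC -sum_nat_const.
  rewrite (bigD1 x0) //= [X in _ < X](bigD1 x0) //= -addSn leq_add //.
    by rewrite ltnNge lt.
  by apply: leq_sum => x _; rewrite ltnW // ltnNge lt.
exists (x |: S); first by rewrite cardsU1; case: (x \notin S); lia.
have sU : U (x |: S) \subset U S :\: Ux x.
  apply/subsetP => P; rewrite inE => /andP[PF /andP[nP /eqP eP]].
  have eP' y : y \in x |: S -> (y \in P.1) = (y \in P.2).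
    by move=> yS; have /setP/(_ y) := eP; rewrite !in_setI yS !andbT.
  have PUx : P \notin Ux x.
    rewrite inE negb_and; apply/orP; right.
    by rewrite !inE (eP' _ (setU11 _ _)); case: (x \in P.2).
  rewrite inE PUx inE PF nP /=.
  apply/eqP/setP => y; rewrite !inE; have [yS|] := boolP (y \in S); last by rewrite !andbF.
  by rewrite !andbT eP' // setU1r.
have UxS : Ux x \subset U S by apply/subsetP => P; rewrite inE => /andP[].
have leU' : #|U (x |: S)| <= #|U S| - #|Ux x|.
  apply: leq_trans (subset_leq_card sU) _.
  by rewrite cardsD (setIidPr UxS).
have step : #|U (x |: S)| * p.+1 <= #|U S| * p by nia.
rewrite -/(U (x |: S)) (expnS p.+1) (expnS p).
have -> : #|U (x |: S)| * (p.+1 * p.+1 ^ l) = (#|U (x |: S)| * p.+1) * p.+1 ^ l by lia.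
apply: leq_trans (leq_mul step (leqnn _)) _.
have := leq_mul (leqnn p) leU; rewrite -/(U S).
move: #|U S| (p.+1 ^ l) (#|F| ^ 2) (p ^ l) => u a b c; nia.
Qed.

(** A weak form of Haussler's packing lemma.  A sample of size logarithmic in
    [#|F|] tells all members of [F] apart, whereas [F] has only polynomially
    many traces on it. *)
Lemma packing d p : exists M, forall (X : finType) (F : {set {set X}}),
  VC F <= d ->
  (forall A B, A \in F -> B \in F -> A != B -> #|X| <= p.+1 * #|symdiff A B|) ->
  #|F| <= M.
Proof.
have [n0 n0P] := exp_dominates_poly ((4 * p.+1) ^ d) d.
exists (2 ^ n0.+1) => X F VCd far.
have [->|[A0 A0F]] := set_0Vmem F; first by rewrite cards0.
have F0 : 0 < #|F| by apply/card_gt0P; exists A0.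
(* Each block of [p.+1] points halves the pairs not told apart, and there are
   fewer than [2 ^ (2 * j.+1)] pairs. *)
pose j := trunc_log 2 #|F|.
have /andP[lejF ltFj] : 2 ^ j <= #|F| < 2 ^ j.+1 by apply: trunc_log_bounds.
have [jn0|] := ltnP j n0.
  by apply: leq_trans (ltnW ltFj) _; rewrite leq_exp2l //; lia.
move=> /n0P; suff : 2 ^ j <= (4 * p.+1) ^ d * j.+1 ^ d by lia.
apply: leq_trans lejF _; pose l := p.+1 * (2 * j.+1).
have [S Sl] := greedy_separation l far.
set U := [set P in _ | _] => leU.
have U0 : U = set0.
  apply/eqP; rewrite -cards_eq0; apply: contraT; rewrite -lt0n => U0.
  have F2 : #|F| ^ 2 < 2 ^ (2 * j.+1) by rewrite mulnC expnM ltn_exp2r.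
  have := exp_ratio p (2 * j.+1); rewrite -/l.
  have := leq_mul U0 (leqnn (p.+1 ^ l)); have : 0 < p.+1 ^ l by rewrite expn_gt0.
  by case: (p ^ l) leU => [|q]; nia.
rewrite -(@card_in_imset _ _ (fun A => A :&: S) F); last first.
  move=> A B AF BF /= /eqP eAB; apply/eqP; apply: contraT => nAB.
  by have : (A, B) \in U; [rewrite !inE /= AF BF nAB eAB | rewrite U0 inE].
apply: leq_trans (sauer_shelah S VCd) _.
rewrite -expnMn; case: d {n0P VCd} => [|d]; first by rewrite !expn0.
by rewrite leq_exp2r //; move: Sl; rewrite /l; lia.
Qed.

(** * Forests and colourings *)

Section Sparse.

Variable G : sgraph.
Implicit Types (S P Q : {set G}) (c : seq G).

(** Stated for a vertex set of [G] rather than for an induced subgraph, so that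
    inductions may remove vertices without changing the graph. *)
Definition acyclic_on S : Prop :=
  forall c, {subset c <= S} -> ucycle (@adj G) c -> size c < 3.

Definition colorable_on S k : Prop :=
  exists f : G -> nat, (forall x, x \in S -> f x < k) /\
    (forall x y, x \in S -> y \in S -> adj x y -> f x != f y).

Lemma acyclic_onS S Q : Q \subset S -> acyclic_on S -> acyclic_on Q.
Proof. by move=> /subsetP QS acS c cQ; apply: acS => x /cQ/QS. Qed.

Lemma chromatic_number_le k : colorable_on [set: G] k -> chromatic_number G <= k.
Proof.
case=> f [fk fadj]; rewrite /chromatic_number.
case: ex_minnP => m _; apply; apply/existsP.
exists [ffun x => Ordinal (fk x (in_setT x))].
apply/forallP => x; apply/forallP => y; apply/implyP => xy.
by rewrite !ffunE -val_eqE /=; apply: fadj.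
Qed.

Lemma chromatic_number_coloring :
  exists f : {ffun G -> 'I_(chromatic_number G)}, proper_coloring f.
Proof.
by rewrite /chromatic_number; case: ex_minnP => m /existsP.
Qed.

Lemma chromatic_number_le_card : chromatic_number G <= #|G|.
Proof.
apply: chromatic_number_le; exists (fun x => nat_of_ord (enum_rank x)); split=> [x _|x y _ _ xy].
  exact: ltn_ord.
by rewrite val_eqE (inj_eq enum_rank_inj); apply: contraTneq xy => ->; rewrite adj_irr.
Qed.

(** Colour greedily in the reverse order of elimination: a vertex with fewer
    than [k] neighbours among the remaining ones always finds a free colour. *)
Lemma degenerate_colorable P k :
  (forall Q, Q \subset P -> Q != set0 ->
     exists2 v, v \in Q & #|nbhd v :&: Q| < k) ->
  colorable_on P k.
Proof.
have [n] := ubnP #|P|; elim: n P => // n IHn P lePn degP.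
have [->|P0] := eqVneq P set0.
  by exists (fun=> 0); split=> [x|x y]; rewrite inE.
have [v vP vk] := degP P (subxx P) P0.
have sP : P :\ v \subset P by apply: subD1set.
have [||f [fk fadj]] := IHn (P :\ v).
- by move: lePn; rewrite (cardsD1 v P) vP; lia.
- by move=> Q QP; apply: degP; apply: subset_trans sP.
pose used := [seq f y | y in nbhd v :&: P].
have [a ak aN] : exists2 a, a < k & a \notin used.
  have /allPn[a] : ~~ all (mem used) (iota 0 k).
    apply/negP => /allP/(uniq_leq_size (iota_uniq 0 k)).
    by rewrite size_iota size_map -cardE leqNgt vk.
  by rewrite mem_iota => ak aN; exists a.
have usedP y : y \in P -> adj v y -> a != f y.
  by move=> yP vy; apply: contraNneq aN => ->; apply: image_f; rewrite !inE vy.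
exists (fun x => if x == v then a else f x); split=> [x xP|x y xP yP xy].
  by have [//|xv] := eqVneq x v; apply: fk; rewrite !inE xv.
have [xv|xv] := eqVneq x v; have [yv|yv] := eqVneq y v.
- by move: xy; rewrite xv yv adj_irr.
- by apply: usedP => //; rewrite -xv.
- by rewrite eq_sym; apply: usedP => //; rewrite adj_sym -yv.
- by apply: fadj => //; rewrite !inE ?xv ?yv.
Qed.

(** Otherwise a path inside [S] could be prolonged forever: its first vertex
    has a neighbour besides the second one, and this neighbour is new because
    an old one would close a cycle. *)
Lemma acyclic_leaf S : acyclic_on S -> S != set0 ->
  exists2 v, v \in S & #|nbhd v :&: S| <= 1.
Proof.
move=> acS /set0Pn[v0 v0S].
have [/existsP[v /andP[vS v1]]|] :=
  boolP [exists v, (v \in S) && (#|nbhd v :&: S| <= 1)]; first by exists v.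
rewrite negb_exists => /forallP deg2.
have long n : exists x p, [/\ size p = n, uniq (x :: p), path (@adj G) x p &
    {subset x :: p <= S}].
  elim: n => [|n [x [p [sp up pp pS]]]].
    by exists v0, [::]; split=> // x; rewrite inE => /eqP->.
  have xS : x \in S by apply: pS; rewrite mem_head.
  have := deg2 x; rewrite xS /= -ltnNge => deg2x.
  have [y yN yh] : exists2 y, y \in nbhd x :&: S & y != head x p.
    move: deg2x; rewrite (cardsD1 (head x p)) => deg2x.
    have /card_gt0P[y] : 0 < #|(nbhd x :&: S) :\ head x p| by case: (_ \in _) deg2x; lia.
    by rewrite in_setD1 => /andP[yh yN]; exists y.
  move: yN; rewrite !inE => /andP[xy yS].
  have [yp|yp] := boolP (y \in x :: p); last first.
    exists y, (x :: p); split=> //=; first by rewrite sp.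
    - by rewrite yp.
    - by rewrite adj_sym xy.
    - by move=> z; rewrite inE => /orP[/eqP->//|]; apply: pS.
  move: yp; rewrite inE => /orP[/eqP yx|yp]; first by rewrite yx adj_irr in xy.
  exfalso; case/splitPr: yp up pp pS yh {sp} => p1 p2 up pp pS yh.
  have : size (x :: rcons p1 y) < 3.
    apply: acS.
      move=> z zc; apply: pS; move: zc.
      by rewrite !inE mem_rcons mem_cat !inE; case: (z == x); case: (z == y);
         case: (z \in p1).
    rewrite /ucycle /ucycleb /= rcons_path last_rcons (adj_sym y) xy andbT.
    move: pp up; rewrite -cat_rcons cat_path => /andP[-> _] /=.
    by rewrite mem_cat cat_uniq negb_or => /andP[/andP[-> _] /andP[-> _]].
  by case: p1 yh {up pp pS} => [|z p1] /=; rewrite ?eqxx // size_rcons.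
have [x [p [sp up _ _]]] := long #|G|.
by have := max_card (mem (x :: p)); rewrite (card_uniqP up) /= sp ltnn.
Qed.

Lemma acyclic_colorable S : acyclic_on S -> colorable_on S 2.
Proof.
move=> acS; apply: degenerate_colorable => Q QS; apply: acyclic_leaf.
exact: acyclic_onS acS.
Qed.

Lemma is_forest_induced S : is_forest (induced S) <-> acyclic_on S.
Proof.
have map_cycle (c : seq (induced S)) :
    ucycleb (@adj (induced S)) c = ucycleb (@adj G) (map val c).
  by rewrite /ucycleb (map_inj_uniq val_inj) cycle_map.
split=> [forS c cS uc|acS [c [c3]]].
  rewrite ltnNge; apply/negP => c3; apply: forS.
  have [c' cE] : exists c' : seq (induced S), c = map val c'.
    elim: c cS {uc c3} => [|x c IHc] cS; first by exists [::].
    have [y yc|c' ->] := IHc; first by apply: cS; rewrite inE yc orbT.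
    by exists (exist _ x (cS _ (mem_head _ _)) :: c').
  exists c'; split; first by move: c3; rewrite cE size_map.
  by have := map_cycle c'; rewrite -cE => e; have := uc : ucycleb _ _; rewrite -e.
move=> uc0; have := uc0 : ucycleb _ _; rewrite map_cycle => {uc0} uc.
have : size (map val c) < 3.
  by apply: acS uc => x /mapP[y _ ->]; apply: valP.
by rewrite size_map ltnNge c3.
Qed.

End Sparse.

(** Embed the leaves last: the neighbour of a leaf is already placed, and its
    [k] neighbours in [Q] cannot all be occupied. *)
Lemma embed_acyclic (M G : sgraph) (S : {set M}) (Q : {set G}) k :
  acyclic_on S -> #|S| <= k -> Q != set0 ->
  (forall v, v \in Q -> k <= #|nbhd v :&: Q|) ->
  exists g : M -> G, [/\ forall x, x \in S -> g x \in Q,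
    {in S &, injective g} &
    forall x y, x \in S -> y \in S -> adj x y -> adj (g x) (g y)].
Proof.
move=> + + /set0Pn[q0 q0Q] degQ.
have [n] := ubnP #|S|; elim: n S => // n IHn S leSn acS Sk.
have [->|S0] := eqVneq S set0.
  by exists (fun=> q0); split=> [x|x y|x y]; rewrite inE.
have [v vS v1] := acyclic_leaf acS S0.
have sS : S :\ v \subset S by apply: subD1set.
have cS : #|S| = #|S :\ v|.+1 by rewrite (cardsD1 v S) vS.
have [||| g [gQ gI gA]] := IHn (S :\ v).
- by rewrite -ltnS -cS.
- exact: acyclic_onS acS.
- by rewrite ltnW // -cS.
(* [w] is where the only neighbour of the leaf went, or any vertex of [Q] if
   the leaf has none. *)
have [w wQ wP] : exists2 w, w \in Q & forall x, x \in S -> adj v x -> w = g x.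
  have [N0|[x xN]] := set_0Vmem (nbhd v :&: S).
    exists q0 => // x xS vx; have : x \in nbhd v :&: S by rewrite !inE vx.
    by rewrite N0 inE.
  exists (g x).
    apply: gQ; move: xN; rewrite !inE => /andP[vx ->]; rewrite andbT.
    by apply: contraTneq vx => ->; rewrite adj_irr.
  move=> y yS vy; congr g; apply/eqP; move: v1; rewrite (cardsD1 x) xN.
  rewrite ltnS leqn0 cards_eq0 => /eqP N0; apply: contraT; rewrite eq_sym => yx.
  have : y \in (nbhd v :&: S) :\ x by rewrite !inE yx vy.
  by rewrite N0 inE.
have /subsetPn[u uN uF] : ~~ (nbhd w :&: Q \subset [set g x | x in S :\ v]).
  apply/negP => /subset_leq_card; rewrite leqNgt; apply/negPn/negPn.
  apply: leq_ltn_trans (leq_imset_card _ _) _; apply: leq_trans (degQ w wQ).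
  by rewrite -cS.
move: uN; rewrite !inE => /andP[wu uQ].
have uF' x : x \in S -> x != v -> u != g x.
  move=> xS xv; apply: contraNneq uF => ->; apply: imset_f.
  by rewrite !inE xv.
exists (fun x => if x == v then u else g x); split=> [x xS|x y xS yS|x y xS yS].
- by have [//|xv] := eqVneq x v; apply: gQ; rewrite !inE xv.
- have [xv|xv] := eqVneq x v; have [yv|yv] := eqVneq y v; rewrite ?xv ?yv //.
  + by move/eqP; rewrite (negPf (uF' _ yS yv)).
  + by move/esym/eqP; rewrite (negPf (uF' _ xS xv)).
  + by apply: gI; rewrite !inE ?xv ?yv.
- have [xv|xv] := eqVneq x v; have [yv|yv] := eqVneq y v; rewrite ?xv ?yv //.
  + by rewrite adj_irr.
  + by move=> /(wP _ yS) <-; rewrite adj_sym.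
  + by rewrite adj_sym => /(wP _ xS) <-.
  + by apply: gA; rewrite !inE ?xv ?yv.
Qed.

Lemma noncolorable_contains_acyclic (M G : sgraph) (S : {set M}) (P : {set G}) :
  acyclic_on S -> ~ colorable_on P #|S| ->
  exists g : M -> G, [/\ forall x, x \in S -> g x \in P,
    {in S &, injective g} &
    forall x y, x \in S -> y \in S -> adj x y -> adj (g x) (g y)].
Proof.
move=> acS ncP.
have [Q [QP Q0 degQ]] : exists Q : {set G}, [/\ Q \subset P, Q != set0 &
    forall v, v \in Q -> #|S| <= #|nbhd v :&: Q|].
  apply: contrapT => noQ; apply: ncP; apply: degenerate_colorable => Q QP Q0.
  apply: contrapT => deg; apply: noQ; exists Q; split=> // v vQ.
  by rewrite leqNgt; apply/negP => lt; apply: deg; exists v.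
have [g [gQ gI gA]] := embed_acyclic acS (leqnn _) Q0 degQ.
by exists g; split=> // x /gQ; apply: (subsetP QP).
Qed.

(** * The Erdos-Stone theorem *)

Lemma subset_of_card (T : finType) (A : {set T}) t :
  t <= #|A| -> exists2 B : {set T}, B \subset A & #|B| = t.
Proof.
move=> tA; exists [set x in take t (enum A)].
  by apply/subsetP => x; rewrite inE => /mem_take; rewrite mem_enum.
rewrite cardsE (card_uniqP (take_uniq _ (enum_uniq _))) size_takel //.
by rewrite -cardE.
Qed.

Section Blowup.

Variable G : sgraph.
Implicit Types (W : {set G}) (A : nat -> {set G}).

(** The blow-up of a complete graph; disjointness of the parts follows from
    irreflexivity of adjacency. *)
Definition complete_parts W s t A : Prop :=
  (forall i, i < s -> A i \subset W /\ #|A i| = t) /\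
  (forall i j x y, i < s -> j < s -> i != j -> x \in A i -> y \in A j -> adj x y).

Lemma common_trace (X : {set G}) (D : {set G}) t :
  t * 2 ^ #|D| <= #|X| -> 0 < t ->
  exists2 Z : {set G}, Z \subset D &
    t <= #|[set w in X | D :&: nbhd w == Z]|.
Proof.
move=> tX t0; apply: contrapT => noZ.
suff : #|X| < t * 2 ^ #|D| by rewrite ltnNge tX.
rewrite mulnC -card_powerset -sum_nat_const -sum1_card.
rewrite (partition_big (fun w => D :&: nbhd w) (mem (powerset D))) /=; last first.
  by move=> w _; rewrite inE subsetIl.
have lt (Z : {set G}) : Z \subset D -> \sum_(w in X | D :&: nbhd w == Z) 1 < t.
  move=> ZD; rewrite ltnNge; apply/negP => le; apply: noZ; exists Z => //.
  by apply: leq_trans le _; rewrite -sum1_card; apply: eq_leq; apply: eq_bigl => w; rewrite inE.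
rewrite (bigD1 set0) ?inE ?sub0set //= [X in _ < X](bigD1 set0) ?inE ?sub0set //=.
rewrite -addSn leq_add ?lt ?sub0set //.
by apply: leq_sum => Z; rewrite inE => /andP[ZD _]; apply/ltnW/lt.
Qed.

End Blowup.

(** The Erdos-Stone theorem when every vertex of [W] misses at most a fraction
    [(1 - 1 / q) / s] of [W]; in this form [s = 0] can start the induction.
    Start from large parts in [W].  By double counting, a positive proportion
    of the vertices of [W] have at least [t] neighbours in every part, and by
    pigeonhole [t] of them have the same neighbours there; these form the new
    part. *)
Lemma erdos_stone s t q : exists N, forall (G : sgraph) (W : {set G}),
  N <= #|W| ->
  (forall v, v \in W -> q * s * #|W :\: nbhd v| + #|W| <= q * #|W|) ->
  exists A, complete_parts W s.+1 t A.
Proof.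
case: t => [|t].
  exists 0 => G W _ _; exists (fun=> set0).
  by split=> [i _|i j x y _ _ _]; rewrite ?sub0set ?cards0 // inE.
elim: s t => [|s IHs] t.
  exists t.+1 => G W /subset_of_card[B BW Bt] _; exists (fun=> B).
  by split=> // -[|i] [|j].
(* A vertex with fewer than [t.+1] neighbours in some part misses almost all of
   it: with parts of this size, more than a fraction [1 - 1 / (2 * q)]. *)
pose T := (2 * q * t.+1).-1; have [N IH] := IHs T.
exists (maxn N (2 * q * (t.+1 * 2 ^ (s.+1 * T.+1))).+1) => G W.
rewrite geq_max => /andP[NW ltW] degW.
have q0 : 0 < q.
  have W0 : 0 < #|W| by apply: leq_trans ltW.
  have [v vW] := card_gt0P W0; case: (posnP q) => // q0.
  by have := degW v vW; rewrite q0 !mul0n add0n leqNgt W0.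
have TE : T.+1 = 2 * q * t.+1 by rewrite /T prednK // !muln_gt0 q0.
have [||A [AW Aadj]] := IH G W => //.
  by move=> v vW; apply: leq_trans (degW v vW); rewrite leq_add2r; nia.
pose D := \bigcup_(i < s.+1) A i.
have DT : #|D| <= s.+1 * T.+1.
  rewrite /D; apply: (@leq_trans (\sum_(i < s.+1) #|A i|)).
    exact: card_bigcup_le.
  under eq_bigr => i _ do rewrite (AW i (ltn_ord i)).2.
  by rewrite sum_nat_const card_ord.
pose good := [set w in W | [forall i : 'I_s.+1, t.+1 <= #|A i :&: nbhd w|]].
have goodW : good \subset W by apply/subsetP => w; rewrite inE => /andP[].
have many : #|W| <= 2 * q * #|good|.
  pose nonadj := \sum_(w in W) \sum_(i < s.+1) #|A i :\: nbhd w|.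
  have upper : q * nonadj <= T.+1 * (q - 1) * #|W|.
    have -> : nonadj = \sum_(i < s.+1) \sum_(v in A i) #|W :\: nbhd v|.
      rewrite /nonadj exchange_big; apply: eq_bigr => i _ /=.
      transitivity (\sum_(w in W) \sum_(v in A i | ~~ adj v w) 1).
        apply: eq_bigr => w _; rewrite -sum1_card; apply: eq_bigl => v.
        by rewrite !inE adj_sym andbC.
      rewrite (exchange_big_dep (mem (A i))) /=; last by move=> w v _ /andP[].
      apply: eq_bigr => v vA; rewrite -sum1_card; apply: eq_bigl => w.
      by rewrite !inE vA andbC.
    rewrite -(leq_pmul2l (ltn0Sn s)) mulnA big_distrr /=.
    apply: (@leq_trans (\sum_(i < s.+1) T.+1 * ((q - 1) * #|W|))); last first.
      by rewrite sum_nat_const card_ord !mulnA.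
    apply: leq_sum => i _; have [AiW Ait] := AW i (ltn_ord i).
    rewrite -{1}Ait -sum_nat_const big_distrr; apply: leq_sum => v /(subsetP AiW)/degW.
    rewrite /= mulnBl mul1n (mulnC s.+1) => le; rewrite -(leq_add2r #|W|) subnK ?leq_pmull //.
  have lower : #|W :\: good| * (T.+1 - t.+1) <= nonadj.
    rewrite -sum_nat_const /nonadj [X in _ <= X](big_setID good) /=.
    apply: leq_trans (leq_addl _ _); apply: leq_sum => w.
    rewrite !inE => /andP[+ wW]; rewrite wW negb_forall => /existsP[i].
    rewrite -ltnNge => lt; rewrite (bigD1 i) //=.
    apply: leq_trans (leq_addr _ _); have [_ <-] := AW i (ltn_ord i).
    by rewrite -(cardsID (nbhd w) (A i)); lia.
  have := cardsID good W; rewrite (setIidPr goodW) => cW.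
  move: lower upper; rewrite TE -cW.
  move: nonadj #|good| #|W :\: good| => x g b lower upper.
  have h1 : q * (b * (2 * q * t.+1 - t.+1)) <= 2 * q * t.+1 * (q - 1) * (g + b).
    by apply: leq_trans upper; rewrite leq_mul2l lower orbT.
  have h2 : b * (2 * q - 1) <= 2 * (q - 1) * (g + b).
    rewrite -(leq_pmul2l (_ : 0 < q * t.+1)) ?muln_gt0 ?q0 //.
    have e : 2 * q * t.+1 - t.+1 = (2 * q - 1) * t.+1 by rewrite mulnBl mul1n.
    by move: h1; rewrite e; move: (2 * q - 1) (q - 1) => a c; lia.
  by case: (q) q0 h2 => // q' _; rewrite subn1 /=; nia.
have [||Z ZD] := @common_trace G good D t.+1.
- have q2 : 0 < 2 * q by rewrite muln_gt0.
  rewrite -(leq_pmul2l q2); apply: leq_trans many; apply: leq_trans (ltnW ltW).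
  by rewrite !leq_mul2l leq_exp2l // DT !orbT.
- by [].
case/subset_of_card => B /subsetP BZ Bt.
have Bgood w : w \in B -> w \in good by move/BZ; rewrite inE => /andP[].
have BtrZ w i x : w \in B -> i < s.+1 -> x \in A i -> adj w x = (x \in Z).
  move=> /BZ; rewrite inE => /andP[_ /eqP <-] lis xA; rewrite !inE.
  suff -> : x \in D by [].
  by apply/bigcupP; exists (Ordinal lis).
have ZA i : i < s.+1 -> exists2 A' : {set G}, A' \subset A i :&: Z & #|A'| = t.+1.
  move=> lis; apply: subset_of_card.
  have /card_gt0P[w wB] : 0 < #|B| by rewrite Bt.
  have := Bgood w wB; rewrite inE => /andP[_ /forallP/(_ (Ordinal lis))/=].
  move=> le; apply: leq_trans le _; apply/subset_leq_card/subsetP => x.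
  by rewrite !inE => /andP[xA]; rewrite xA (BtrZ _ _ _ wB lis xA).
have [A' A'P] : exists A' : nat -> {set G}, forall i, i < s.+1 ->
    A' i \subset A i :&: Z /\ #|A' i| = t.+1.
  have /choice[A' A'P] : forall i, exists A' : {set G}, i < s.+1 ->
      A' \subset A i :&: Z /\ #|A'| = t.+1.
    move=> i; have [/ZA[A' ? ?]|_] := ltnP i s.+1; last by exists set0.
    by exists A'.
  by exists A'.
have A'sub i x : i < s.+1 -> x \in A' i -> (x \in A i) && (x \in Z).
  by move=> /A'P[/subsetP sub _] /sub; rewrite inE.
exists (fun i => if i < s.+1 then A' i else B); split=> [i _|i j x y].
  case: ifP => [lis|_].
    split; last by have [] := A'P i lis.
    by apply/subsetP => x /(A'sub _ _ lis)/andP[xA _]; apply: (subsetP (AW i lis).1).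
  by split=> //; apply/subsetP => x /Bgood; apply: (subsetP goodW).
rewrite !ltnS => lis ljs nij; case: ifP => [li|/negbT li]; case: ifP => [lj|/negbT lj].
- by move=> /(A'sub _ _ li)/andP[xA _] /(A'sub _ _ lj)/andP[yA _]; apply: (Aadj i j).
- by move=> /(A'sub _ _ li)/andP[xA xZ] yB; rewrite adj_sym (BtrZ y i).
- by move=> xB /(A'sub _ _ lj)/andP[yA yZ]; rewrite (BtrZ x j).
- by case/eqP: nij; lia.
Qed.

(** Parts of size [#|H|] have room for any class: each vertex goes to the member
    of its part that has the rank of the vertex in [H]. *)
Lemma contains_join (H G : sgraph) (S : {set H}) (g : H -> G)
    (col : H -> nat) s (W : {set G}) A :
  {in S &, injective g} ->
  (forall x y, x \in S -> y \in S -> adj x y -> adj (g x) (g y)) ->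
  (forall x, x \notin S -> col x < s) ->
  (forall x y, x \notin S -> y \notin S -> adj x y -> col x != col y) ->
  complete_parts W s #|H| A ->
  (forall x w, x \in S -> w \in W -> adj (g x) w) ->
  contains G H.
Proof.
move=> gI gadj cols coladj [AW Aadj] gW.
pose h x := nth (g x) (enum (A (col x))) (enum_rank x).
have hA x : x \notin S -> h x \in A (col x).
  move=> /cols/AW[_ cA]; rewrite -mem_enum mem_nth //.
  by rewrite -cardE cA ltn_ord.
have hW x : x \notin S -> h x \in W.
  by move=> xS; apply: (subsetP (AW _ (cols _ xS)).1); apply: hA.
have gh x y : x \in S -> y \notin S -> adj (g x) (h y).
  by move=> xS /hW; apply: gW.
have neq (x y : G) : adj x y -> x = y -> False.
  by move=> xy e; rewrite e adj_irr in xy.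
exists (fun x => if x \in S then g x else h x); split=> x y; last first.
  case: ifP => [xS|/negbT xS]; case: ifP => [yS|/negbT yS] xy.
  - exact: gadj.
  - exact: gh.
  - by rewrite adj_sym; apply: gh.
  - by apply: (Aadj (col x) (col y)); rewrite ?cols ?coladj ?hA.
case: ifP => [xS|/negbT xS]; case: ifP => [yS|/negbT yS].
- exact: gI.
- by move/(neq _ _ (gh _ _ xS yS)).
- by move/esym/(neq _ _ (gh _ _ yS xS)).
have [ecol|ncol] := eqVneq (col x) (col y); last first.
  by move/(neq _ _ (Aadj _ _ _ _ (cols _ xS) (cols _ yS) ncol (hA _ xS) (hA _ yS))).
have sz z : z \notin S -> enum_rank z < size (enum (A (col z))).
  by move=> /cols/AW[_ cA]; rewrite -cardE cA ltn_ord.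
rewrite /h -ecol (set_nth_default (g x)); last by rewrite ecol sz.
move/eqP; rewrite nth_uniq ?enum_uniq ?sz //; last by rewrite ecol sz.
by move/eqP/val_inj/enum_rank_inj.
Qed.

(** * Upper bounds *)

Lemma colorable_by_classes (G : sgraph) (cls : G -> nat) M k :
  (forall v, cls v < M) ->
  (forall i, i < M -> colorable_on [set v | cls v == i] k) ->
  colorable_on [set: G] (M * k).
Proof.
move=> clsM colM.
have /choice[f fP] : forall i, exists f : G -> nat, i < M ->
    (forall x, cls x = i -> f x < k) /\
    (forall x y, cls x = i -> cls y = i -> adj x y -> f x != f y).
  move=> i; have [/colM[f [fk fadj]]|_] := ltnP i M; last by exists (fun=> 0).
  exists f => _; split=> [x xi|x y xi yi]; first by apply: fk; rewrite inE xi.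
  by apply: fadj; rewrite inE ?xi ?yi.
have fk x : f (cls x) x < k by have [h _] := fP _ (clsM x); apply: h.
have k0 (x : G) : 0 < k by exact: leq_ltn_trans (leq0n _) (fk x).
exists (fun x => cls x * k + f (cls x) x); split=> [x _|x y _ _ xy].
  apply: (@leq_trans ((cls x).+1 * k)); first by rewrite mulSn addnC ltn_add2r.
  by rewrite leq_mul2r clsM orbT.
apply/eqP => e; have ecls : cls x = cls y.
  have := congr1 (fun n => n %/ k) e.
  by rewrite !divnMDl ?(k0 x) // !divn_small ?fk // !addn0.
have [_ /(_ x y erefl (esym ecls) xy)] := fP _ (clsM x).
by move: e; rewrite ecls => /addnI ->; rewrite eqxx.
Qed.

Lemma dense_free_bounded (H : sgraph) s q (col : H -> nat) :
  (forall x, col x < s.+1) -> (forall x y, adj x y -> col x != col y) ->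
  exists N, forall G : sgraph, Defs.free H G ->
    (forall v : G, q * s * #|~: nbhd v| + #|G| <= q * #|G|) -> #|G| <= N.
Proof.
move=> cols coladj; have [N NP] := erdos_stone s #|H| q.
exists N => G freeG degG; rewrite leqNgt; apply/negP => ltN; apply: freeG.
have [v0 _] : exists v0 : G, v0 \in [set: G].
  by apply/card_gt0P; rewrite cardsT; apply: leq_ltn_trans ltN.
have [||A AP] := NP G [set: G].
- by rewrite cardsT ltnW.
- by move=> v _; rewrite cardsT setTD.
apply: (@contains_join H G set0 (fun=> v0) col s.+1 [set: G] A) => //.
- by move=> x y; rewrite inE.
- by move=> x y; rewrite inE.
- by move=> x y _ _; apply: coladj.
- by move=> x w; rewrite inE.
Qed.

(** A maximal family of pairwise far neighbourhoods is close to every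
    neighbourhood. *)
Lemma nbhd_net (G : sgraph) p : 0 < #|G| ->
  exists F : {set {set G}}, [/\ F \subset [set nbhd v | v : G],
    forall A B, A \in F -> B \in F -> A != B -> #|G| <= p.+1 * #|symdiff A B| &
    forall v, exists2 A, A \in F & p.+1 * #|symdiff A (nbhd v)| < #|G|].
Proof.
move=> G0; pose sep (F : {set {set G}}) := (F \subset [set nbhd v | v : G]) &&
  [forall A in F, forall B in F, (A != B) ==> (#|G| <= p.+1 * #|symdiff A B|)].
have [F /maxsetP[/andP[FN /forall_inP sepF] maxF]] : {F | maxset sep F}.
  apply: ex_maxset; exists set0; rewrite /sep sub0set.
  by apply/forall_inP => A; rewrite inE.
have sepF' A B : A \in F -> B \in F -> A != B -> #|G| <= p.+1 * #|symdiff A B|.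
  by move=> /sepF/forall_inP h /h/implyP.
have symC (A B : {set G}) : symdiff A B = symdiff B A by rewrite /symdiff setUC.
exists F; split=> // v; apply: contrapT => far.
have far' A : A \in F -> #|G| <= p.+1 * #|symdiff A (nbhd v)|.
  by move=> AF; rewrite leqNgt; apply/negP => lt; apply: far; exists A.
have vF : nbhd v \in F.
  rewrite -(maxF (nbhd v |: F)) ?setU11 ?subsetU1 //.
  rewrite /sep subUset sub1set imset_f //= FN /=.
  apply/forall_inP => A AF; apply/forall_inP => B BF; apply/implyP => nAB.
  move: AF BF nAB; rewrite !inE => /orP[/eqP->|AF] /orP[/eqP->|BF] nAB.
  - by rewrite eqxx in nAB.
  - by rewrite symC far'.
  - exact: far'.
  - exact: sepF'.
have := far' _ vF; rewrite /symdiff setDv setU0 cards0 muln0.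
by rewrite leqNgt G0.
Qed.

(** The vertices are sorted into boundedly many classes of vertices with
    nearly the same neighbourhood.  A class that needs many colours contains
    the acyclic part of [H]; the common neighbourhood [W] of the vertices used
    is nearly the whole neighbourhood of a single vertex, so it is large and
    dense enough for the remaining classes of [H] to be found inside it. *)
Lemma bounded_VC_chromatic (H : sgraph) (S : {set H}) s q d (col : H -> nat) :
  acyclic_on S ->
  (forall x, x \notin S -> col x < s.+1) ->
  (forall x y, x \notin S -> y \notin S -> adj x y -> col x != col y) ->
  exists C, forall G : sgraph, Defs.free H G -> graph_VC G <= d ->
    (forall v : G, q * s.+1 * #|~: nbhd v| + #|G| <= q * #|G|) ->
    chromatic_number G <= C.
Proof.
move=> acS cols coladj; have [N NP] := erdos_stone s #|H| q.
(* With this precision the common neighbourhood of [h] vertices of one class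
   misses at most [#|G| / (2 * Q)] vertices of the neighbourhood that represents
   the class. *)
pose Q := q * s.+1; pose h := #|S|; pose p := (2 * Q * h.+1).-1.
have [M MP] := packing d p.
exists (maxn (2 * Q * N) (M * h)) => G freeG VCG degG; rewrite leq_max.
have [leN|ltN] := leqP #|G| (2 * Q * N).
  by rewrite (leq_trans (chromatic_number_le_card G)).
apply/orP; right; have G0 : 0 < #|G| by apply: leq_ltn_trans ltN.
have q0 : 0 < q.
  have [v _] := card_gt0P G0; case: (posnP q) => // q0.
  by have := degG v; rewrite q0 !mul0n add0n leqNgt G0.
have pE : p.+1 = 2 * Q * h.+1 by rewrite /p prednK // !muln_gt0 q0.
have [F [FN sepF netF]] := nbhd_net p G0.
have FM : #|F| <= M.
  by apply: (MP G F) => //; apply: leq_trans VCG; apply: VC_subset.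
have /choice[rep repP] : forall v : G, exists A : {set G},
    A \in F /\ p.+1 * #|symdiff A (nbhd v)| < #|G|.
  by move=> v; have [A ? ?] := netF v; exists A.
apply: chromatic_number_le.
apply: (@colorable_by_classes G (fun v => index (rep v) (enum F)) M h) => [v|i iM].
  apply: leq_trans FM; rewrite cardE index_mem mem_enum.
  by have [] := repP v.
apply: contrapT => /(noncolorable_contains_acyclic acS)[g [gP gI gadj]].
pose A := nth set0 (enum F) i.
have near x : x \in S -> rep (g x) = A.
  move=> /gP; rewrite inE /A => /eqP <-; rewrite nth_index // mem_enum.
  by have [] := repP (g x).
have [v0 AE] : exists v0 : G, #|~: nbhd v0| = #|~: A| \/ S = set0.
  have [->|[x xS]] := set_0Vmem S; first by have [v _] := card_gt0P G0; exists v; right.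
  have [] := repP (g x); rewrite near // => /(subsetP FN)/imsetP[v _ ->] _.
  by exists v; left.
pose W := [set w | [forall x in S, adj (g x) w]].
apply: freeG.
have WA : 2 * Q * #|W| + 2 * Q * #|~: nbhd v0| + #|G| >= 2 * Q * #|G|.
  case: AE => [->|S0].
    have AW : p.+1 * #|A :\: W| <= h * #|G|.
      have sub : A :\: W \subset \bigcup_(x in S) (A :\: nbhd (g x)).
        apply/subsetP => w; rewrite !inE negb_forall => /andP[/existsP[x]].
        rewrite negb_imply => /andP[xS ngw] wA; apply/bigcupP; exists x => //.
        by rewrite !inE ngw.
      apply: (@leq_trans (p.+1 * \sum_(x in S) #|A :\: nbhd (g x)|)).
        rewrite leq_mul2l; apply/orP; right.
        apply: leq_trans (subset_leq_card sub) _.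
        exact: card_bigcup_le.
      rewrite big_distrr /= -sum_nat_const; apply: leq_sum => x xS.
      have [_] := repP (g x); rewrite near // => /ltnW le; apply: leq_trans le.
      by rewrite leq_mul2l subset_leq_card ?orbT // subsetUl.
    have AW2 : 2 * Q * #|A :\: W| <= #|G|.
      rewrite -(leq_pmul2l (ltn0Sn h)) mulnA (mulnC h.+1) -pE.
      by apply: leq_trans AW _; rewrite leq_mul2r leqnSn orbT.
    have := cardsC A; have := cardsID W A; have := subset_leq_card (subsetIr A W).
    by move: AW2; nia.
  have -> : W = [set: G].
    by apply/setP => w; rewrite !inE; apply/forall_inP => x; rewrite S0 inE.
  by rewrite cardsT; lia.
have degv0 := degG v0; rewrite -/Q in degv0.
have WL : 2 * q * s * #|G| + #|G| <= 2 * Q * #|W|.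
  have : 2 * Q * #|G| = 2 * q * s * #|G| + 2 * q * #|G|.
    by rewrite /Q mulnS; lia.
  by lia.
have Q2 : 0 < 2 * Q by rewrite !muln_gt0 q0.
have [||B BP] := NP G W.
- by rewrite -(leq_pmul2l Q2); lia.
- move=> v _; rewrite -(leq_pmul2l Q2).
  have : #|W :\: nbhd v| <= #|~: nbhd v|.
    by apply/subset_leq_card/subsetP => w; rewrite !inE => /andP[].
  move=> xy; have Qx : Q * #|W :\: nbhd v| <= (q - 1) * #|G|.
    have := degG v; rewrite -/Q mulnBl mul1n.
    by have := leq_mul (leqnn Q) xy; lia.
  have step1 := leq_mul (leqnn (2 * q * s)) Qx.
  have step2 := leq_mul (leqnn (q - 1)) WL.
  have -> : q * #|W| = (q - 1) * #|W| + #|W| by rewrite mulnBl mul1n subnK ?leq_pmull.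
  rewrite !mulnDr leq_add2r.
  by move: step1 step2; rewrite !mulnDr; nia.
apply: (contains_join gI gadj cols coladj BP) => x w xS.
by rewrite inE => /forall_inP; apply.
Qed.

(** * Random multigraphs *)

Lemma card_ffun_constrained (E P : finType) (A : {set E}) (B : {set P}) :
  #|[set w : {ffun E -> P} | [forall e in A, w e \in B]]| =
  #|B| ^ #|A| * #|P| ^ #|~: A|.
Proof.
pose F e : pred P := [pred y | (e \in A) ==> (y \in B)].
transitivity #|family F|.
  apply: eq_card => w; rewrite inE; apply/forall_inP/familyP => [wB e|wF e eA].
    by rewrite /F inE; apply/implyP; apply: wB.
  by have := wF e; rewrite /F inE eA.
rewrite card_family foldrE big_map big_enum /= (bigID (mem A)) /=; congr (_ * _).
  rewrite -prod_nat_const; apply: eq_bigr => e eA.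
  by apply: eq_card => y; rewrite !inE eA.
rewrite -prod_nat_const; apply: eq_big => [e|e /negPf eA]; first by rewrite inE.
by apply: eq_card => y; rewrite !inE eA.
Qed.

(** A cycle of length [l] gives [l] edges inside a set of [l] vertices.  It is
    simpler to count such pairs than cycles, and for loops ([l = 1]) and
    parallel edges ([l = 2]) they make sense as well. *)
Section RandomGraph.

Variables n m : nat.
Implicit Types (w : {ffun 'I_m -> 'I_n * 'I_n}) (c : {set 'I_n} * {set 'I_m}).

Definition witness l c := (#|c.1| == l) && (#|c.2| == l).

Definition inside w c := [forall e in c.2, w e \in setX c.1 c.1].

Definition witnesses w N := [set c | inside w c & [exists l : 'I_N, witness l.+1 c]].

Lemma sum_witness l K : m = K * n ->
  \sum_w #|[set c | inside w c & witness l c]| <= (K * (l * l)) ^ l * (n * n) ^ m.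
Proof.
move=> mE.
have -> : \sum_w #|[set c | inside w c & witness l c]| =
    \sum_(c | witness l c) #|[set w | inside w c]|.
  under eq_bigr => w _ do rewrite -sum1_card.
  rewrite (exchange_big_dep (witness l)) /=; last by move=> w c _; rewrite inE => /andP[].
  by apply: eq_bigr => c wc; rewrite -sum1_card; apply: eq_bigl => w; rewrite !inE wc andbT.
apply: (@leq_trans (\sum_(c | witness l c) (l * l) ^ l * (n * n) ^ (m - l))).
  apply: leq_sum => c /andP[/eqP c1 /eqP c2].
  by rewrite /inside card_ffun_constrained [#|~: _|]cardsCs setCK cardsX card_prod !card_ord c1 c2.
rewrite sum_nat_const.
have -> : #|[pred c | witness l c]| = 'C(n, l) * 'C(m, l).
  have := card_draws 'I_n l; have := card_draws 'I_m l.
  rewrite !card_ord => <- <-; rewrite -cardsX.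
  by apply: eq_card => c; rewrite !inE.
have [lm|lm] := leqP l m; last by rewrite (bin_small lm) muln0 mul0n.
rewrite -{3}(subnKC lm) expnD !mulnA leq_mul2r; apply/orP; right.
rewrite (mulnAC ('C(n, l))) -!mulnA mulnA.
apply: leq_trans (leq_mul (leq_mul (bin_le_exp n l) (leqnn _)) (bin_le_exp m l)) _.
rewrite mE -!expnMn; apply: eq_leq; congr (_ ^ _); lia.
Qed.

(** The expected number of witnesses is bounded independently of [n]; conclude
    by Markov's inequality. *)
Lemma few_witnesses N K T : m = K * n -> 0 < n ->
  T = 2 * \sum_(l < N) (K * (l.+1 * l.+1)) ^ l.+1 ->
  2 * #|[set w | T < #|witnesses w N|]| < (n * n) ^ m.
Proof.
move=> mE n0; set Q := \sum_(l < N) _ => TE.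
have sumX : \sum_w #|witnesses w N| <= Q * (n * n) ^ m.
  rewrite /Q big_distrl /=.
  apply: (@leq_trans (\sum_(l < N) \sum_w #|[set c | inside w c & witness l.+1 c]|)).
    rewrite exchange_big; apply: leq_sum => w _ /=.
    have -> : witnesses w N = \bigcup_(l < N) [set c | inside w c & witness l.+1 c].
      apply/setP => c; rewrite inE; apply/andP/bigcupP => [[ic /existsP[l wl]]|[l _]].
        by exists l => //; rewrite inE ic.
      by rewrite inE => /andP[ic wl]; split=> //; apply/existsP; exists l.
    exact: card_bigcup_le.
  by apply: leq_sum => l _; apply: sum_witness.
have nm0 : 0 < (n * n) ^ m by rewrite expn_gt0 muln_gt0 n0.
set B := [set w | _].
have le : T.+1 * #|B| <= Q * (n * n) ^ m.
  apply: leq_trans sumX; rewrite mulnC -sum_nat_const (bigID (mem B) xpredT) /=.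
  by apply: leq_trans (leq_addr _ _); apply: leq_sum => w; rewrite inE.
rewrite -(ltn_pmul2l (ltn0Sn T)); apply: (@leq_ltn_trans (T * (n * n) ^ m)).
  by rewrite mulnCA [X in _ <= X * _]TE -mulnA leq_mul2l le.
by rewrite ltn_mul2r nm0 /=.
Qed.

Definition outside w c := [forall e in ~: c.2, w e \in ~: setX c.1 c.1].

Definition sparse_set w k T c :=
  [&& n <= k * #|c.1|, #|c.2| <= T & outside w c].

(** A sparse set is what an independent set of [n / k] vertices becomes once the
    at most [T] removed edges are put back.  For a fixed pair, each of the
    at least [2 * k ^ 2 * n] other edges fails to lie inside the vertex set with
    probability at most [1 - 1 / k ^ 2], hence all of them do with probability
    at most [1 / 4 ^ n], which leaves room for a union bound over all pairs. *)
Lemma few_sparse_sets k T : 0 < k -> m = 3 * (k * k) * n -> T <= n ->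
  2 * m.+1 ^ T < 2 ^ n ->
  2 * #|[set w | [exists P, sparse_set w k T P]]| < (n * n) ^ m.
Proof.
move=> k0 mE Tn big.
have n0 : 0 < n.
  case: (posnP n) => // n0; move: big; rewrite n0 expn0.
  by have : 0 < m.+1 ^ T; [rewrite expn_gt0 | lia].
have nm0 : 0 < (n * n) ^ m by rewrite expn_gt0 muln_gt0 n0.
have [p pE] : exists p, k * k = p.+1 by exists (k * k).-1; rewrite prednK // muln_gt0 k0.
pose dom : {set {set 'I_n} * {set 'I_m}} :=
  [set P : {set 'I_n} * {set 'I_m} | (n <= k * #|P.1|) && (#|P.2| <= T)].
set B := [set w | _].
have leB : #|B| <= \sum_(P in dom) #|[set w | outside w P]|.
  apply: (@leq_trans #|\bigcup_(P in dom) [set w | outside w P]|).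
    apply/subset_leq_card/subsetP => w; rewrite inE => /existsP[P /and3P[P1 P2 P3]].
    by apply/bigcupP; exists P; rewrite inE ?P1.
  exact: card_bigcup_le.
have Tm : T <= m by rewrite mE pE; clear -Tn; nia.
have term P : P \in dom ->
    p.+1 ^ (m - T) * #|[set w | outside w P]| <=
    p ^ (m - T) * (n * n) ^ m.
  rewrite inE => /andP[P1 P2]; rewrite /outside card_ffun_constrained setCK.
  rewrite [#|~: setX _ _|]cardsCs [#|~: P.2|]cardsCs !setCK cardsX card_prod !card_ord.
  set a := n * n - _; set D := #|P.2| in P2 *.
  have an : a <= n * n by apply: leq_subr.
  have pa : p.+1 * a <= p * (n * n).
    have : n * n <= p.+1 * (#|P.1| * #|P.1|).
      by rewrite -pE mulnACA; apply: leq_mul.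
    by rewrite /a mulnBr mulSn; clear; lia.
  have h1 : p.+1 ^ (m - T) * a ^ (m - T) <= p ^ (m - T) * (n * n) ^ (m - T).
    by rewrite -!expnMn; case: (m - T) => // r; rewrite leq_exp2r.
  have h2 : a ^ (T - D) <= (n * n) ^ (T - D).
    by case: (T - D) => // r; rewrite leq_exp2r.
  have -> : m - D = (m - T) + (T - D) by clearbody D; clear -Tm P2; lia.
  have -> : (n * n) ^ m = (n * n) ^ (m - T) * ((n * n) ^ (T - D) * (n * n) ^ D).
    by rewrite -!expnD; congr (_ ^ _); clearbody D; clear -Tm P2; lia.
  rewrite expnD -!mulnA [X in X <= _]mulnA [X in _ <= X]mulnA leq_mul //.
  by rewrite leq_mul2r h2 orbT.
have dom_le : #|dom| <= 2 ^ n * m.+1 ^ T.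
  apply: (@leq_trans #|setX (powerset [set: 'I_n])
    [set Y : {set 'I_m} | (Y \subset [set: 'I_m]) && (#|Y| <= T)]|).
    by apply/subset_leq_card/subsetP => P; rewrite !inE !subsetT => /andP[].
  rewrite cardsX card_powerset cardsT card_ord leq_mul2l.
  by apply/orP; right; have := card_small_subsets [set: 'I_m] T; rewrite cardsT card_ord.
have tot : p.+1 ^ (m - T) * #|B| <= 2 ^ n * m.+1 ^ T * (p ^ (m - T) * (n * n) ^ m).
  apply: leq_trans (leq_mul (leqnn _) leB) _; rewrite big_distrr /=.
  apply: (@leq_trans (\sum_(P in dom) p ^ (m - T) * (n * n) ^ m)); first exact: leq_sum.
  by rewrite sum_nat_const leq_mul2r dom_le orbT.
have [r rE] : exists r, m - T = p.+1 * (2 * n) + r.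
  exists (m - T - p.+1 * (2 * n)); rewrite subnKC // mE pE; clear -Tn; nia.
have ratio : 2 ^ (2 * n) * p ^ (m - T) <= p.+1 ^ (m - T).
  rewrite rE [p ^ _]expnD [p.+1 ^ _]expnD mulnA leq_mul //; first exact: exp_ratio.
  by case: (r) => // r'; rewrite leq_exp2r.
have pos : 0 < p.+1 ^ (m - T) by rewrite expn_gt0.
rewrite -(ltn_pmul2l pos).
have {}tot : p.+1 ^ (m - T) * (2 * #|B|) <=
    2 ^ n * (2 * m.+1 ^ T) * p ^ (m - T) * (n * n) ^ m.
  by have := leq_mul (leqnn 2) tot; rewrite -!mulnA !(mulnCA 2).
apply: leq_ltn_trans tot _; rewrite ltn_mul2r nm0 /=.
have [p0|p0] := posnP (p ^ (m - T)); first by rewrite p0 muln0.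
apply: leq_trans ratio; rewrite ltn_mul2r p0 /= (mul2n n) -addnn expnD.
by rewrite ltn_mul2l expn_gt0 big.
Qed.

End RandomGraph.

(** * Girth and chromatic number *)

Section EdgeGraph.

Variables (n m : nat) (w : {ffun 'I_m -> 'I_n * 'I_n}) (D : {set 'I_m}).

Definition edge_adj : rel 'I_n := fun x y =>
  (x != y) && [exists e in ~: D, (w e == (x, y)) || (w e == (y, x))].

Lemma edge_adj_sym : symmetric edge_adj.
Proof.
move=> x y; rewrite /edge_adj eq_sym; congr (_ && _).
by apply: eq_existsb => e; rewrite [(w e == _) || _]orbC.
Qed.

Lemma edge_adj_irr : irreflexive edge_adj.
Proof. by move=> x; rewrite /edge_adj eqxx. Qed.

Definition edge_graph := SGraph edge_adj_sym edge_adj_irr.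

End EdgeGraph.

Lemma next_next_neq (T : eqType) (c : seq T) x :
  uniq c -> 3 <= size c -> x \in c -> next c (next c x) != x.
Proof.
move=> uc c3 xc; have [i s rE] := rot_to xc.
have nE := next_rot i uc; rewrite -(nE x) -nE rE; have := c3; rewrite -(size_rot i) rE.
have := uc; rewrite -(rot_uniq i) rE.
case: s {rE} => [//|a [//|b s]] /=; rewrite !inE !negb_or => /andP[/and3P[xa xb _] _] _.
by rewrite eqxx (eq_sym a) (negPf xa) eqxx eq_sym.
Qed.

(** The edges of a cycle through [l] vertices carry [l] different indices:
    otherwise two consecutive steps of the cycle would cancel. *)
Lemma cycle_witness n m (w : {ffun 'I_m -> 'I_n * 'I_n}) (D : {set 'I_m})
    (c : seq (edge_graph w D)) : ucycle (@adj (edge_graph w D)) c -> 3 <= size c ->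
  exists P, [/\ inside w P, witness (size c) P & P.2 \subset ~: D].
Proof.
move=> /andP[cc uc] c3.
have /choice[e eP] : forall x, exists e : 'I_m, x \in c -> e \in ~: D /\
    (w e = (x, next c x) \/ w e = (next c x, x)).
  move=> x; have [xc|xc] := boolP (x \in c).
    have := next_cycle cc xc => /andP[_ /exists_inP[e eD]].
    by move=> /orP[/eqP|/eqP] ?; exists e => _; split=> //; [left|right].
  have m0 : 0 < m.
    case: c cc {uc xc} c3 => [//|y c] cc _.
    have /andP[_ /exists_inP[e _ _]] := next_cycle cc (mem_head y c).
    by apply: leq_ltn_trans (ltn_ord e).
  by exists (Ordinal m0).
have eI : {in c &, injective e}.
  move=> x y xc yc exy.
  have [_ ex] := eP x xc; have [_ ey] := eP y yc.
  move: ex ey; rewrite exy => -[] -> [] [] //.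
  - move=> xy yx; have := next_next_neq uc c3 xc.
    by rewrite yx -xy eqxx.
  - move=> xy yx; have := next_next_neq uc c3 xc.
    by rewrite xy -yx eqxx.
exists ([set x in c], [set e x | x in c]); split=> /=.
- apply/forall_inP => _ /imsetP[x xc ->]; rewrite !inE.
  by have [_ [->|->]] := eP x xc; rewrite /= ?mem_next xc.
- by rewrite /witness /= card_in_imset // !cardsE !(card_uniqP uc) !eqxx.
- by apply/subsetP => _ /imsetP[x xc ->]; have [] := eP x xc.
Qed.

(** Erdos's theorem on girth and chromatic number, by deletion.  A random
    multigraph has at most [T] witnesses of short cycles and no sparse set, so
    an edge may be removed from each witness without creating a large
    independent set. *)
Theorem erdos_girth_chromatic N k : exists F : sgraph,
  (forall c : seq F, ucycle (@adj F) c -> size c <= N -> size c < 3) /\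
  k < chromatic_number F.
Proof.
have [K KE] : exists K, K = 3 * (k.+1 * k.+1) by eexists.
have [T TE] : exists T, T = 2 * \sum_(l < N.+1) (K * (l.+1 * l.+1)) ^ l.+1 by eexists.
have [n [n_gt0 Tn ltn]] : exists n, [/\ 0 < n, T <= n & 2 * (K * n).+1 ^ T < 2 ^ n].
  have [n0 n0P] := exp_dominates_poly (2 * K ^ T) T.
  exists (maxn n0 T).+1; split=> //; first by rewrite leqW ?leq_maxr.
  apply: leq_ltn_trans (n0P _ _); last by rewrite leqW ?leq_maxl.
  rewrite -mulnA leq_mul2l /= -expnMn; case: (T) => // r.
  by rewrite leq_exp2r // [X in _ <= X]mulnS -add1n leq_add2r KE !muln_gt0.
have [m mE] : exists m, m = K * n by eexists.
have [w [wT wS]] : exists w : {ffun 'I_m -> 'I_n * 'I_n},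
    #|witnesses w N.+1| <= T /\ ~~ [exists P, sparse_set w k.+1 T P].
  have lt1 := few_witnesses mE n_gt0 TE.
  have lt2 : 2 * #|[set w : {ffun 'I_m -> 'I_n * 'I_n} |
      [exists P, sparse_set w k.+1 T P]]| < (n * n) ^ m.
    by apply: few_sparse_sets; rewrite -?KE -?mE // mE.
  set B1 := [set w | _] in lt1; set B2 := [set w | _] in lt2.
  have : #|B1 :|: B2| < #|[set: {ffun 'I_m -> 'I_n * 'I_n}]|.
    rewrite cardsT card_ffun card_prod !card_ord.
    have := (leq_card_setU B1 B2).1; move: lt1 lt2.
    by move: #|B1| #|B2| #|_ :|: _| (_ ^ m) => a b c d; clear; lia.
  rewrite ltnNge; apply: contraNP => now; apply/subset_leq_card/subsetP => w _.
  rewrite !inE; apply/negPn; rewrite negb_or -leqNgt; apply/negP => /andP[w1 w2].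
  by apply: now; exists w.
have m_gt0 : 0 < m by rewrite mE KE !muln_gt0.
pose chosen (P : {set 'I_n} * {set 'I_m}) := odflt (Ordinal m_gt0) [pick e in P.2].
pose D := [set chosen P | P in witnesses w N.+1].
have DT : #|D| <= T by apply: leq_trans (leq_imset_card _ _) wT.
have hitD P l : l <= N -> inside w P -> witness l.+1 P -> exists2 e, e \in P.2 & e \in D.
  move=> lN iP wP; exists (chosen P); last first.
    apply: imset_f; rewrite inE iP; apply/existsP.
    by exists (Ordinal (lN : l < N.+1)).
  rewrite /chosen; case: pickP => // P0; move: wP; rewrite /witness => /andP[_].
  by rewrite eq_card0.
exists (edge_graph w D); split=> [c uc cN|].
  rewrite ltnNge; apply/negP => c3; have [P [iP wP PD]] := cycle_witness uc c3.
  have [||e eP eD] := @hitD P (size c).-1 _ iP.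
  - by case: (size c) cN => // l; apply: ltnW.
  - by rewrite prednK //; apply: leq_trans c3.
  by have := subsetP PD e eP; rewrite inE eD.
(* A colour class of at least average size contains both ends of a remaining edge [e],
   which is not a loop because loops are witnesses. *)
rewrite ltnNge; apply/negP => chi_le.
have [f /forallP fP] := chromatic_number_coloring (edge_graph w D).
have [a na] : exists a, n <= k.+1 * #|[set x | f x == a]|.
  apply/existsP; apply: contraT; rewrite negb_exists => /forallP small.
  have sumn : n = \sum_a #|[set x | f x == a]|.
    rewrite -[LHS]card_ord -sum1_card (partition_big f xpredT) //=.
    by apply: eq_bigr => a _; rewrite -sum1_card; apply: eq_bigl => x; rewrite inE.
  have le : \sum_a (k.+1 * #|[set x | f x == a]|).+1 <=
      \sum_(a < chromatic_number (edge_graph w D)) n.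
    by apply: leq_sum => a _; rewrite ltnNge.
  exfalso; move: le; rewrite sum_nat_const card_ord.
  under eq_bigr => a _ do rewrite -addn1.
  rewrite big_split /= -big_distrr /= -sumn sum1_card card_ord.
  have : 0 < chromatic_number (edge_graph w D).
    by case: (chromatic_number _) (f (Ordinal n_gt0)) => // -[].
  have := leq_mul chi_le (leqnn n).
  by move: (chromatic_number _) => x; clear; nia.
move: wS; rewrite negb_exists => /forallP/(_ ([set x | f x == a], D)).
rewrite /sparse_set /= na DT /= negb_forall => /existsP[e].
rewrite negb_imply !inE negbK => /and3P[eD /eqP fx /eqP fy].
have [exy|nxy] := eqVneq (w e).1 (w e).2; last first.
  have := fP (w e).1 => /forallP/(_ (w e).2)/implyP; rewrite fx fy eqxx /=.
  case/(_ _)/wrap => //; rewrite /edge_adj nxy; apply/exists_inP.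
  by exists e; rewrite ?inE -?surjective_pairing ?eqxx.
have [|||e'] := @hitD ([set (w e).1], [set e]) 0 => //.
- by apply/forall_inP => e'; rewrite inE => /eqP ->; rewrite !inE /= exy eqxx.
- by rewrite /witness /= !cards1.
by rewrite inE => /eqP ->; rewrite (negPf eD).
Qed.

(** * The extremal graphs *)

Lemma mindeg_le (G : sgraph) (v : G) : mindeg G <= #|nbhd v|.
Proof.
rewrite /mindeg; elim: (index_enum G) (mem_index_enum v) => [//|x l IHl].
rewrite inE big_cons => /orP[/eqP ->|/IHl le]; first exact: geq_minl.
by rewrite geq_min le orbT.
Qed.

Lemma mindeg_ge (G : sgraph) a :
  a <= #|G| -> (forall v : G, a <= #|nbhd v|) -> a <= mindeg G.
Proof.
move=> aG aN; apply: (big_ind (fun d => a <= d)) => // x y ax ay.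
by rewrite leq_min ax.
Qed.

(** The obstruction to containment in the extremal graphs below. *)
Definition splits (H : sgraph) s : Prop :=
  exists (S : {set H}) (col : H -> nat), [/\ acyclic_on S,
    forall x, x \notin S -> col x < s &
    forall x y, x \notin S -> y \notin S -> adj x y -> col x != col y].

Section CompleteMultipartite.

Variables (F : sgraph) (s : nat).

Definition multi_adj : rel ('I_s.+1 * F)%type := fun u v =>
  (u.1 != v.1) || ((u.1 == ord0) && adj u.2 v.2).

Lemma multi_adj_sym : symmetric multi_adj.
Proof.
move=> u v; rewrite /multi_adj eq_sym adj_sym.
by have [->|] := eqVneq v.1 u.1.
Qed.

Lemma multi_adj_irr : irreflexive multi_adj.
Proof. by move=> u; rewrite /multi_adj eqxx adj_irr andbF. Qed.

(** The complete multipartite graph on [s.+1] copies of the vertices of [F],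
    with the edges of [F] added inside the part of index [ord0]. *)
Definition multi := SGraph multi_adj_sym multi_adj_irr.

Lemma multi_mindeg : s * #|multi| <= s.+1 * mindeg multi.
Proof.
have cardG : #|multi| = s.+1 * #|F| by rewrite card_prod card_ord.
rewrite cardG mulnCA leq_mul2l; apply/orP; right.
apply: mindeg_ge => [|u]; first by rewrite cardG leq_mul2r leqnSn orbT.
apply: (@leq_trans #|setX [set~ u.1] [set: F]|).
  by rewrite cardsX cardsT cardsC1 card_ord.
apply/subset_leq_card/subsetP => v; rewrite !inE andbT => uv.
by rewrite /= /multi_adj eq_sym uv.
Qed.

Lemma multi_chromatic : chromatic_number F <= chromatic_number multi.
Proof.
have [f /forallP fP] := chromatic_number_coloring multi.
apply: chromatic_number_le; exists (fun x => f (ord0, x)); split=> [x _|x y _ _ xy].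
  exact: ltn_ord.
have := fP (ord0, x) => /forallP/(_ (ord0, y))/implyP; rewrite -val_eqE; apply.
by rewrite /= /multi_adj eqxx.
Qed.

(** Outside the part containing [F] the neighbourhoods shatter no two points;
    inside it they shatter no four, because two vertices of a graph without
    4-cycles have at most one common neighbour. *)
Lemma multi_VC :
  (forall c : seq F, ucycle (@adj F) c -> size c = 4 -> False) ->
  graph_VC multi <= 4.
Proof.
move=> no4; apply: VC_le => Y /shatteredP shY.
have traceP (Z : {set multi}) : Z \subset Y ->
    exists u : multi, forall y, y \in Y -> (y \in Z) = multi_adj u y.
  move=> /shY[_ /imsetP[u _ ->] <-]; exists u => y yY.
  by rewrite !inE yY andbT.
pose P0 := [set u : multi | u.1 == ord0].
have out : #|Y :\: P0| <= 1.
  rewrite leqNgt; apply/negP => /card_gt1P[a [b [aY bY nab]]].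
  move: aY bY; rewrite !inE => /andP[a0 aY] /andP[b0 bY].
  have adjE u (y : multi) : y.1 != ord0 -> multi_adj u y = (u.1 != y.1).
    move=> y0; rewrite /multi_adj; have [->|//] := eqVneq u.1 y.1.
    by rewrite (negPf y0).
  have [u uP] := traceP set0 (sub0set _).
  have [|v vP] := traceP [set a]; first by rewrite sub1set.
  move: (uP a aY) (uP b bY) (vP a aY) (vP b bY).
  rewrite !inE !adjE // eqxx (eq_sym b) (negPf nab).
  by move=> /esym/negbFE/eqP <- /esym/negbFE/eqP <- <-.
have ins : #|Y :&: P0| <= 3.
  rewrite leqNgt cardE; have := enum_uniq (mem (Y :&: P0)).
  have : {subset enum (Y :&: P0) <= Y :&: P0} by move=> x; rewrite mem_enum.
  case: (enum _) => [|a [|b [|c [|e l]]]] //= sub uE; exfalso.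
  have part y : y \in [:: a, b, c, e & l] -> y \in Y /\ y.1 = ord0.
    by move=> /sub; rewrite !inE => /andP[-> /eqP].
  have [aY a0] : a \in Y /\ a.1 = ord0 by apply: part; rewrite !inE eqxx.
  have [bY b0] : b \in Y /\ b.1 = ord0 by apply: part; rewrite !inE eqxx orbT.
  have [cY c0] : c \in Y /\ c.1 = ord0 by apply: part; rewrite !inE eqxx !orbT.
  have [eY e0] : e \in Y /\ e.1 = ord0 by apply: part; rewrite !inE eqxx !orbT.
  move: uE; rewrite !inE !negb_or.
  case/and5P=> /and4P[nab nac nae _] /and3P[nbc nbe _] /andP[nce _] _ _.
  have [|u uP] := traceP [set a; b].
    by apply/subsetP => y; rewrite !inE => /orP[]/eqP->.
  have [|v vP] := traceP [set a; b; c].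
    by apply/subsetP => y; rewrite !inE => /orP[/orP[]|]/eqP->.
  move: (uP a aY) (uP b bY) (uP c cY) (vP a aY) (vP b bY) (vP c cY) (vP e eY).
  rewrite !inE !eqxx !orbT /= !(eq_sym c) !(eq_sym e).
  rewrite (negPf nac) (negPf nbc) (negPf nae) (negPf nbe) (negPf nce) /=.
  rewrite /multi_adj a0 b0 c0 e0.
  have [u0|//] := eqVneq u.1 ord0; have [v0|//] := eqVneq v.1 ord0.
  rewrite /= => /esym ua /esym ub /esym uc /esym va /esym vb /esym vc _.
  apply: (no4 [:: a.2; u.2; b.2; v.2]) => //.
  have neq (x y : F) : adj x y -> x != y.
    by move=> xy; apply: contraTneq xy => ->; rewrite adj_irr.
  have nab2 : a.2 != b.2.
    apply: contra nab => /eqP ab; apply/eqP.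
    by rewrite [a]surjective_pairing [b]surjective_pairing a0 b0 ab.
  have nuv : u.2 != v.2 by apply: contraFneq uc => ->.
  rewrite /ucycle /ucycleb /= !inE !negb_or nab2 nuv.
  rewrite (adj_sym a.2) ua ub (adj_sym b.2) vb va /=.
  by rewrite (eq_sym a.2) !neq // adj_sym.
by rewrite -(cardsID P0 Y); apply: (@leq_add _ _ 3 1).
Qed.

Lemma multi_contains_splits (H : sgraph) :
  (forall c : seq F, ucycle (@adj F) c -> size c <= #|H| -> size c < 3) ->
  contains multi H -> splits H s.
Proof.
move=> girth [g [gI gadj]].
exists [set x | (g x).1 == ord0], (fun x => (g x).1.-1); split.
- move=> c cS /andP[cc uc].
  have c0 x : x \in c -> (g x).1 = ord0 by move=> /cS; rewrite inE => /eqP.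
  have cI : {in c &, injective (fun x => (g x).2)}.
    move=> x y xc yc e; apply: gI.
    by rewrite [g x]surjective_pairing [g y]surjective_pairing !c0 // e.
  rewrite -(size_map (fun x => (g x).2)); apply: girth; last first.
    by rewrite size_map -(card_uniqP uc) max_card.
  rewrite /ucycle /ucycleb map_inj_in_uniq // uc andbT cycle_map.
  apply: (sub_in_cycle (P := mem c)) cc; last by apply/allP.
  by move=> x y xc yc /gadj; rewrite /= /multi_adj !c0 // eqxx.
- move=> x; rewrite inE => x0; have := ltn_ord (g x).1.
  by move: x0; rewrite -val_eqE /=; lia.
- move=> x y; rewrite !inE => x0 y0 /gadj; rewrite /= /multi_adj (negPf x0) orbF.
  by move: x0 y0; rewrite -!val_eqE /=; lia.
Qed.

End CompleteMultipartite.

(** The colours 0 and 1 are those of the forest, so the colouring remembers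
    [S]. *)
Lemma splits_coloring (H : sgraph) s (S : {set H}) (col : H -> nat) :
  acyclic_on S -> (forall x, x \notin S -> col x < s) ->
  (forall x y, x \notin S -> y \notin S -> adj x y -> col x != col y) ->
  exists f : H -> nat, [/\ forall x, f x < s.+2,
    forall x y, adj x y -> f x != f y & forall x, (f x < 2) = (x \in S)].
Proof.
move=> acS cols coladj; have [h [h2 hadj]] := acyclic_colorable acS.
exists (fun x => if x \in S then h x else (col x).+2).
split=> [x|x y xy|x].
- by case: ifP => [/h2|/negbT/cols]; lia.
- case: ifP => [xS|/negbT xS]; case: ifP => [yS|/negbT yS].
  + exact: hadj.
  + by have := h2 x xS; lia.
  + by have := h2 y yS; lia.
  + by rewrite !eqSS coladj.
- by case: ifP => [/h2|].
Qed.

Lemma splits_chromatic (H : sgraph) s : splits H s -> chromatic_number H <= s.+2.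
Proof.
move=> [S [col [acS cols coladj]]].
have [f [f2 fadj _]] := splits_coloring acS cols coladj.
by apply: chromatic_number_le; exists f; split=> [x _|x y _ _]; [apply: f2|apply: fadj].
Qed.

Lemma splits_decomposition (H : sgraph) s : chromatic_number H = s.+2 ->
  splits H s <-> exists M, decomposition_family H M /\ is_forest M.
Proof.
move=> chiH; split=> [[S [col [acS cols coladj]]]|[M [[f [i [j [fP nij ->]]]] forM]]].
  have [f [f2 fadj fS]] := splits_coloring acS cols coladj.
  have f2' x : f x < chromatic_number H by rewrite chiH.
  have i0 : 0 < chromatic_number H by rewrite chiH.
  have i1 : 1 < chromatic_number H by rewrite chiH.
  exists (induced S); split; last exact/is_forest_induced.
  exists [ffun x => Ordinal (f2' x)], (Ordinal i0), (Ordinal i1); split=> //.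
    apply/forallP => x; apply/forallP => y; apply/implyP => xy.
    by rewrite !ffunE -val_eqE /=; apply: fadj.
  congr induced; apply/setP => x; rewrite !inE !ffunE -!val_eqE /= -fS.
  by case: (f x) => [|[|]].
exists (f @^-1: [set i] :|: f @^-1: [set j]), (fun x => index (f x) (enum (~: [set i; j]))).
have notin x : x \notin f @^-1: [set i] :|: f @^-1: [set j] ->
    f x \in enum (~: [set i; j]).
  by rewrite mem_enum !inE.
split; first exact/is_forest_induced.
  have cs : #|~: [set i; j]| = s.
    by rewrite cardsCs setCK cards2 nij card_ord chiH; lia.
  by move=> x /notin; rewrite -index_mem -cardE cs.
move=> x y /notin xN /notin yN xy; apply/eqP => /index_inj-/(_ (f x) xN yN)/eqP.
apply/negP; move: fP => /forallP/(_ x)/forallP/(_ y)/implyP; exact.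
Qed.

Lemma unbounded_chromatic (H : sgraph) s C : ~ splits H s ->
  exists G : sgraph, [/\ Defs.free H G, graph_VC G <= 4,
    s * #|G| <= s.+1 * mindeg G & C < chromatic_number G].
Proof.
move=> nsH; have [F [girth chiF]] := erdos_girth_chromatic (maxn 4 #|H|) C.
exists (multi F s); split.
- move=> /multi_contains_splits; move=> cont; apply: nsH; apply: cont => c uc cH.
  by apply: girth => //; rewrite leq_max cH orbT.
- apply: multi_VC => c uc c4; have := girth c uc.
  by rewrite c4 leq_max => /(_ isT).
- exact: multi_mindeg.
- exact: leq_trans chiF (multi_chromatic F s).
Qed.

(** * The threshold *)

Local Open Scope ring_scope.

(** For every [c] above [s / s.+1] there is a [q] such that minimum degree
    [c * #|G|] leaves each vertex at most [(1 - 1 / q) * #|G| / s.+1]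
    non-neighbours; this condition, cleared of denominators, is the one in the
    second hypothesis. *)
Lemma threshold_eq (R : realType) (H : sgraph) s :
  ~ splits H s ->
  (forall q d, exists C, forall G : sgraph, Defs.free H G -> (graph_VC G <= d)%N ->
    (forall v : G, q * s.+1 * #|~: nbhd v| + #|G| <= q * #|G|)%N ->
    (chromatic_number G <= C)%N) ->
  VC_chromatic_threshold R H = s%:R / s.+1%:R.
Proof.
move=> nsH bound; rewrite /VC_chromatic_threshold.
set A := (X in inf X); set t := s%:R / s.+1%:R.
have s1 : 0 < s.+1%:R :> R by rewrite ltr0n.
have t_ge0 : 0 <= t by rewrite divr_ge0 ?ler0n.
have lower c : A c -> t <= c.
  move=> [c0 /(_ 4)[C CP]]; rewrite leNgt; apply/negP => ct.
  have [G [freeG VCG degG chiG]] := unbounded_chromatic C nsH.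
  suff : (chromatic_number G <= C)%N by rewrite leqNgt chiG.
  apply: CP => //; apply: (@le_trans _ _ (t * #|G|%:R)).
    by rewrite ler_wpM2r ?ler0n // ltW.
  by rewrite /t mulrAC ler_pdivrMr // -!natrM ler_nat (mulnC (mindeg G)).
have upper c : t < c -> A c.
  move=> tc; split; first by apply: le_trans (ltW tc).
  pose e : R := s.+1%:R * c - s%:R.
  have e0 : 0 < e by rewrite subr_gt0 mulrC -ltr_pdivrMr.
  have [q qe] : exists q : nat, 1 <= q%:R * e.
    exists (Num.bound e^-1); rewrite -ler_pdivrMr // mul1r.
    by apply/ltW/archi_boundP; rewrite invr_ge0 ltW.
  move=> d; have [C CP] := bound q d; exists C => G freeG VCG degG.
  apply: CP => // v; rewrite -(ler_nat R) natrD !natrM.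
  have abn : #|nbhd v|%:R + #|~: nbhd v|%:R = #|G|%:R :> R by rewrite -natrD cardsC.
  have ma : (mindeg G)%:R <= #|nbhd v|%:R :> R by rewrite ler_nat mindeg_le.
  have n0 : 0 <= #|G|%:R :> R by [].
  have b_le : 0 <= #|G|%:R - c * #|G|%:R - #|~: nbhd v|%:R by lra.
  have := mulr_ge0 (mulr_ge0 (ler0n R q) (ltW s1)) b_le.
  have : 0 <= #|G|%:R * (q%:R * e - 1) by rewrite mulr_ge0 // subr_ge0.
  rewrite /e -(natr1 s); lra.
apply/eqP; rewrite eq_le; apply/andP; split; last first.
  by apply: lb_le_inf; [exists (t + 1); apply: upper; rewrite ltrDl|].
apply/ler_addgt0Pr => e e0; apply: ge_inf; first by exists t.
by apply: upper; rewrite ltrDl.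
Qed.

Theorem theorem1p1 (R : realType) (H : sgraph) (r : nat)
    (chiH : chromatic_number H = r) (r_ge3 : (3 <= r)%N) :
  VC_chromatic_threshold R H =
    if `[< exists M : sgraph, decomposition_family H M /\ is_forest M >]
    then (r%:R - 3) / (r%:R - 2)
    else (r%:R - 2) / (r%:R - 1).
Proof.
case: r chiH r_ge3 => [//|[//|[//|s]]] chiH _.
have natE k l : (k <= l)%N -> l%:R - k%:R = (l - k)%:R :> R by move=> /natrB.
rewrite (natE 3) // !(natE 2) // (natE 1%N) // !subSS !subn0.
case: asboolP => [[M [famM forM]]|noforest].
  have /(splits_decomposition chiH)[S [col [acS cols coladj]]] :
    exists M, decomposition_family H M /\ is_forest M by exists M.
  apply: threshold_eq => [/splits_chromatic|q d]; first by rewrite chiH ltnn.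
  exact: bounded_VC_chromatic acS cols coladj.
apply: threshold_eq => [/(splits_decomposition chiH)//|q d].
have [f /forallP fP] := chromatic_number_coloring H.
have [|x y xy|N NP] := @dense_free_bounded H s.+2 q (fun x => f x).
- by move=> x; rewrite -chiH ltn_ord.
- by have := fP x => /forallP/(_ y)/implyP; rewrite -val_eqE; apply.
exists N => G freeG _ degG.
by apply: leq_trans (chromatic_number_le_card G) _; apply: NP.
Qed.
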